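(* Let $D$ be a domain in $\mathbb{R}^2$ and let $u$ be panharmonic in $D$, i.e. $u$ is a real-valued $C^2(D)$ solution of $\nabla^2 u - \mu^2 u = 0$ for some $\mu \in \mathbb{R}\setminus\{0\}$. Then $$a(\mu r)\,u(x) = \frac{1}{\pi r^2}\int_{B_r(x)} u(y)\,\log\frac{r}{|x-y|}\,\mathrm{d}y, \qquad a(t) = \frac{2\,[I_0(t)-1]}{t^2},$$ for every $x \in D$ and every $r>0$ with $\overline{B_r(x)} \subset D$.
   Context: $B_r(x) = \{y : |y-x| < r\}$ is the open disc; $I_0$ is the modified Bessel function of order $0$. *)

(* Defs.v *)
From HB Require Import structures.
From mathcomp Require Import all_boot all_order all_algebra.
From mathcomp Require Import all_classical all_reals all_analysis.
Set Implicit Arguments. Unset Strict Implicit. Unset Printing Implicit Defensive.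
Import Order.TTheory GRing.Theory Num.Theory.
Import numFieldNormedType.Exports.
Local Open Scope classical_set_scope.
Local Open Scope ring_scope.

Section Defs.
Variable R : realType.
Implicit Types (u : R * R -> R) (p x y : R * R).

Definition dist2 x y : R := Num.sqrt ((x.1 - y.1) ^+ 2 + (x.2 - y.2) ^+ 2).

Definition disc x (r : R) : set (R * R) := [set y | dist2 x y < r].
Definition cdisc x (r : R) : set (R * R) := [set y | dist2 x y <= r].

Definition pd1 u : R * R -> R := fun p => derive1 (fun t => u (t, p.2)) p.1.
Definition pd2 u : R * R -> R := fun p => derive1 (fun t => u (p.1, t)) p.2.
Definition pd1_ex u p := derivable (fun t => u (t, p.2)) p.1 1.
Definition pd2_ex u p := derivable (fun t => u (p.1, t)) p.2 1.

Definition C1_on (D : set (R * R)) u :=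
  (forall p, D p -> {for p, continuous u}) /\
  (forall p, D p -> pd1_ex u p /\ pd2_ex u p) /\
  (forall p, D p -> {for p, continuous (pd1 u)} /\ {for p, continuous (pd2 u)}).

Definition C2_on (D : set (R * R)) u :=
  C1_on D u /\ C1_on D (pd1 u) /\ C1_on D (pd2 u).

Definition laplacian u : R * R -> R := fun p => pd1 (pd1 u) p + pd2 (pd2 u) p.

Definition panharmonic (mu : R) (D : set (R * R)) u :=
  C2_on D u /\ forall p, D p -> laplacian u p - mu ^+ 2 * u p = 0.

Definition besselI0 (t : R) : R :=
  limn (fun n : nat => \sum_(k < n) ((t / 2) ^+ (2 * k) / ((k`!) ^ 2)%:R)).

Definition afun (t : R) : R := 2 * (besselI0 t - 1) / t ^+ 2.

Definition leb2 := ((@lebesgue_measure R) \x (@lebesgue_measure R))%E.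

End Defs.

(* Main.v *)
Require Import Defs.
From HB Require Import structures.
From mathcomp Require Import all_boot all_order all_algebra.
From mathcomp Require Import all_classical all_reals all_analysis.
From mathcomp Require Import ring lra zify.
From mathcomp Require Import measurable_realfun.
Set Implicit Arguments. Unset Strict Implicit. Unset Printing Implicit Defensive.
Import Order.TTheory GRing.Theory Num.Theory.
Import numFieldNormedType.Exports.
Local Open Scope classical_set_scope.
Local Open Scope ring_scope.

(** Let w(y) = 1 - |y - x|^2 / r^2 on the disc and M_k the integral of w^k u
    over it. For k >= 2 the weight w^k and its gradient vanish on the circle, so
    integrating [w^k * laplacian u] by parts twice along the horizontal and the
    vertical chords gives, with [laplacian u = mu^2 u],
      mu^2 r^2 M_(k+2) = 4 (k+2) ((k+1) M_k - (k+2) M_(k+1)).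
    Since w^k concentrates at x, (k+1) M_k / (pi r^2) tends to u(x), and this
    limit selects the solution u(x) 0F1(;k+2;(mu r/2)^2) of the recurrence, which
    extended one step down to k = -1 is u(x) I_0(mu r). Finally
    log (r / |x - y|) = - log (1 - w) / 2 is half the sum of the w^k / k, and by the
    recurrence the sum of the M_k / k telescopes. *)

(** The kernel [log (r / |x - y|)] is singular at [x], so Green's identity does not apply to it
    directly. The powers of [w] are polynomials, and on a single chord the identity is the
    fundamental theorem of calculus for a Wronskian-type expression. Fubini then suffices: neither
    polar coordinates nor curve integrals occur. Put [V_k = (k+1) M_k / (pi r^2)] and
    [z = (mu r / 2)^2]. The recurrence becomes [V_k = V_(k+1) + z V_(k+2) / ((k+2) (k+3))]. It has
    order two, yet the limit alone fixes the solution, because a solution tending to 0 vanishes. As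
    [k] decreases to -1 the density [(k+1) w^k] concentrates on the circle, so the value one step
    down plays the role of the mean of [u] over the circle, whence [I_0]. Writing [a_n = V_(n-1)],
    with [a_0] defined by the recurrence, one gets [M_(k+1) / (k+1) = pi r^2 (a_k - a_(k+1)) / z],
    which is the telescoping. *)

(** * Borel sets and continuous functions for the product sigma-algebra *)

Section PlaneMeasurability.
Variable R : realType.
Let plane := (measurableTypeR R * measurableTypeR R)%type.

(** Second countability links the product topology to the product sigma-algebra: an open set is the
    union of the countably many rational boxes it contains. *)
Lemma open_measurable_plane (A : set (R * R)) : open A -> measurable (A : set plane).
Proof.
move=> oA.
pose box (q : (rat * rat) * (rat * rat)) : set plane :=
  `]ratr q.1.1 : R, ratr q.1.2[%classic `*` `]ratr q.2.1 : R, ratr q.2.2[%classic.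
pose F q := if `[< box q `<=` A >] then box q else set0.
have -> : A = \bigcup_q F q.
  apply/seteqP; split => [p Ap|p [q _]]; last first.
    by rewrite /F; case: ifPn => // /asboolP; apply.
  have /nbhs_ballP[e /= e0 sA] : nbhs p A by exact: open_nbhs_nbhs.
  have itv (c : R) : exists ab : rat * rat,
      `](ratr ab.1 : R), ratr ab.2[%classic c /\
      `](ratr ab.1 : R), ratr ab.2[%classic `<=` ball c e.
    have [a] := @rat_in_itvoo R (c - e) c ltac:(lra).
    rewrite in_itv/= => /andP[a1 a2].
    have [b] := @rat_in_itvoo R c (c + e) ltac:(lra).
    rewrite in_itv/= => /andP[b1 b2].
    exists (a, b); rewrite ball_itv; split => /=; first by rewrite in_itv/= a2 b1.
    by move=> y /=; rewrite !in_itv/= => /andP[? ?]; apply/andP; split; lra.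
  have [q1 [p1 s1]] := itv p.1; have [q2 [p2 s2]] := itv p.2.
  exists (q1, q2) => //; rewrite /F ifT//; apply/asboolP => y [/= y1 y2].
  by apply: sA; split; [exact: s1|exact: s2].
apply: countable_bigcupT_measurable => // q; rewrite /F; case: ifP => _.
  by apply: measurableX; exact: measurable_itv.
exact: measurable0.
Qed.

Lemma continuous_measurable_plane (D : set (R * R)) (f : R * R -> R) :
  open D -> (forall p, D p -> {for p, continuous f}) ->
  measurable_fun (D : set plane) f.
Proof.
move=> oD cf; apply: (measurability _ (RGenOpens.measurableE R)).
move=> _ [_ [a [b ->] <-]]; apply: open_measurable_plane.
rewrite openE => p [Dp fp]; apply: filterI.
  exact: open_nbhs_nbhs.
by apply: cf => //; apply: open_nbhs_nbhs; split => //; exact: interval_open.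
Qed.

End PlaneMeasurability.

Lemma continuous_exprn (R : realType) (T : topologicalType) (f : T -> R) n p :
  {for p, continuous f} -> {for p, continuous (fun y => f y ^+ n)}.
Proof.
move=> cf; apply: (@continuous_comp _ _ _ f (fun z => z ^+ n) p cf).
exact: exprn_continuous.
Qed.

(** * Discs *)

Section Disc.
Variable R : realType.
Let plane := (measurableTypeR R * measurableTypeR R)%type.
Let mu2 : {measure set plane -> \bar R} := @leb2 R.
Variables (x : R * R) (r : R).
Hypothesis r0 : 0 < r.

Definition weight (y : R * R) : R :=
  1 - ((y.1 - x.1) ^+ 2 + (y.2 - x.2) ^+ 2) / r ^+ 2.

Lemma discP y : disc x r y <-> 0 < weight y.
Proof.
rewrite /disc/= /dist2 /weight subr_gt0 ltr_pdivrMr ?exprn_gt0// mul1r.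
rewrite -{1}[r]ger0_norm ?(ltW r0)// -sqrtr_sqr ltr_sqrt ?exprn_gt0//.
by rewrite -(sqrrN (x.1 - _)) -(sqrrN (x.2 - _)) !opprB.
Qed.

Lemma cdiscP y : cdisc x r y <-> 0 <= weight y.
Proof.
rewrite /cdisc/= /dist2 /weight subr_ge0 ler_pdivrMr ?exprn_gt0// mul1r.
rewrite -{1}[r]ger0_norm ?(ltW r0)// -sqrtr_sqr ler_sqrt ?sqr_ge0//.
by rewrite -(sqrrN (x.1 - _)) -(sqrrN (x.2 - _)) !opprB.
Qed.

Lemma disc_cdisc : disc x r `<=` cdisc x r.
Proof. by move=> y /discP/ltW/cdiscP. Qed.

Lemma weight_le1 y : weight y <= 1.
Proof. by rewrite /weight lerBlDr lerDl divr_ge0 ?addr_ge0 ?sqr_ge0. Qed.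

Lemma continuous_weight : continuous weight.
Proof.
move=> y; apply: cvgB; first exact: cvg_cst.
apply: cvgM; last exact: cvg_cst.
apply: cvgD.
  apply: (@continuous_exprn _ _ (fun z : R * R => z.1 - x.1) 2 y); apply: cvgB; last exact: cvg_cst.
  exact: cvg_fst.
apply: (@continuous_exprn _ _ (fun z : R * R => z.2 - x.2) 2 y); apply: cvgB; last exact: cvg_cst.
exact: cvg_snd.
Qed.

Lemma open_disc : open (disc x r).
Proof.
have -> : disc x r = weight @^-1` [set t | 0 < t].
  by apply/seteqP; split => y => [/discP//|h]; apply/discP.
apply: open_comp => [y _|]; [exact: continuous_weight|exact: open_gt].
Qed.

Lemma measurable_disc : measurable (disc x r : set plane).
Proof. by apply: open_measurable_plane; exact: open_disc. Qed.

Lemma cdisc_box y : cdisc x r y ->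
  (x.1 - r <= y.1 <= x.1 + r) /\ (x.2 - r <= y.2 <= x.2 + r).
Proof.
move=> /cdiscP; rewrite /weight subr_ge0 ler_pdivrMr ?exprn_gt0// mul1r => h.
have l (s : R) : s ^+ 2 <= r ^+ 2 -> - r <= s <= r.
  move=> sr; rewrite -ler_norml -[leRHS](ger0_norm (ltW r0)).
  by rewrite -!sqrtr_sqr ler_sqrt ?sqr_ge0.
have /l/andP[? ?] : (y.1 - x.1) ^+ 2 <= r ^+ 2.
  by apply: le_trans h; rewrite lerDl sqr_ge0.
have /l/andP[? ?] : (y.2 - x.2) ^+ 2 <= r ^+ 2.
  by apply: le_trans h; rewrite lerDr sqr_ge0.
by split; apply/andP; split; lra.
Qed.

Lemma compact_cdisc : compact (cdisc x r).
Proof.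
apply: (@subclosed_compact _ _
  (`[x.1 - r, x.1 + r]%classic `*` `[x.2 - r, x.2 + r]%classic)).
- have -> : cdisc x r = weight @^-1` [set t | 0 <= t].
    by apply/seteqP; split => y => [/cdiscP//|h]; apply/cdiscP.
  apply: closed_comp => [y _|]; [exact: continuous_weight|exact: closed_ge].
- by apply: compact_setX; exact: segment_compact.
- by move=> y /cdisc_box[? ?]; split => /=; rewrite in_itv.
Qed.

Lemma disc_finite : (mu2 (disc x r) < +oo)%E.
Proof.
pose I1 : set R := `[x.1 - r, x.1 + r]%classic.
pose I2 : set R := `[x.2 - r, x.2 + r]%classic.
pose B : set plane := I1 `*` I2.
have mB : measurable B by apply: measurableX; exact: measurable_itv.
apply: (@le_lt_trans _ _ (mu2 B)).
  apply: le_measure; rewrite ?inE//; first exact: measurable_disc.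
  by move=> y /disc_cdisc/cdisc_box[? ?]; rewrite /B /I1 /I2; split => /=; rewrite in_itv.
have -> : mu2 B = (lebesgue_measure I1 * lebesgue_measure I2)%E.
  by apply: product_measure1E; exact: measurable_itv.
by rewrite !lebesgue_measure_itv/=; do 2 (case: ifPn => _);
  rewrite -?EFinB -?EFinM ?mul0e ?mule0 ltry.
Qed.

Lemma continuous_cdisc_bounded (f : R * R -> R) :
  (forall p, cdisc x r p -> {for p, continuous f}) ->
  exists2 M, 0 <= M & forall p, cdisc x r p -> `|f p| <= M.
Proof.
move=> cf.
have : compact (f @` cdisc x r).
  apply: continuous_compact compact_cdisc.
  by apply: continuous_in_subspaceT => p; rewrite inE => /cf.
move/compact_bounded => [M [_ fM]].
exists (`|M| + 1); first by rewrite addr_ge0.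
move=> p pD; apply: (fM (`|M| + 1)); last by exists p.
by rewrite (le_lt_trans (ler_norm _))// ltrDl.
Qed.

(** Continuity is asked on the closed disc because compactness there supplies the bound; the open
    disc has finite measure. *)
Lemma integrable_disc (f : R * R -> R) :
  (forall p, cdisc x r p -> {for p, continuous f}) ->
  mu2.-integrable (disc x r) (EFin \o f).
Proof.
move=> cf; apply: measurable_bounded_integrable.
- exact: measurable_disc.
- exact: disc_finite.
- by apply: continuous_measurable_plane => [|p /disc_cdisc/cf//]; exact: open_disc.
- have [M M0 fM] := continuous_cdisc_bounded cf.
  exists M; split; first exact: num_real.
  by move=> N MN p /disc_cdisc/fM/le_trans; apply; exact: ltW.
Qed.

Definition oball (c h : R) : set R := `]c - h, c + h[%classic.

Definition halfchord (s : R) := Num.sqrt (r ^+ 2 - s ^+ 2).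

Lemma chord_ineq (a b : R) : a ^+ 2 + b ^+ 2 < r ^+ 2 <->
  - r < b < r /\ - halfchord b < a < halfchord b.
Proof.
have sq (c d : R) : 0 < d -> (- d < c < d) = (c ^+ 2 < d ^+ 2).
  move=> d0; rewrite -ltr_norml -{1}[d]ger0_norm ?(ltW d0)//.
  by rewrite -[in RHS]ltr_sqrt ?exprn_gt0// !sqrtr_sqr.
rewrite sq//; split => [h|[h1]].
  have h1 : b ^+ 2 < r ^+ 2 by apply: le_lt_trans h; rewrite lerDr sqr_ge0.
  split => //; rewrite sq /halfchord ?sqrtr_gt0 ?subr_gt0// sqr_sqrtr; first lra.
  by rewrite subr_ge0 ltW.
rewrite sq /halfchord ?sqrtr_gt0 ?subr_gt0// sqr_sqrtr; first lra.
by rewrite subr_ge0 ltW.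
Qed.

Lemma disc_chord2 t s : disc x r (t, s) <->
  oball x.2 r s /\ oball x.1 (halfchord (s - x.2)) t.
Proof.
have E (a b c : R) : (a - b < c < a + b) = (- b < c - a < b).
  by apply/idP/idP => /andP[? ?]; apply/andP; split; lra.
rewrite /oball/= !in_itv/= !E -chord_ineq discP /weight subr_gt0.
by rewrite ltr_pdivrMr ?exprn_gt0// mul1r.
Qed.

Lemma disc_chord1 t s : disc x r (t, s) <->
  oball x.1 r t /\ oball x.2 (halfchord (t - x.1)) s.
Proof.
have E (a b c : R) : (a - b < c < a + b) = (- b < c - a < b).
  by apply/idP/idP => /andP[? ?]; apply/andP; split; lra.
rewrite /oball/= !in_itv/= !E -chord_ineq discP /weight subr_gt0.
by rewrite ltr_pdivrMr ?exprn_gt0// mul1r [in X in _ <-> X]addrC.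
Qed.

(** Fubini for [f] extended by 0 to the plane: the section of the disc at height [s] is a horizontal
    chord, empty when [s] is outside [oball x.2 r]. *)
Lemma integral_disc21 (f : R * R -> R) :
  (forall p, cdisc x r p -> {for p, continuous f}) ->
  (\int[mu2]_(y in disc x r) (f y)%:E =
   \int[lebesgue_measure]_(s in oball x.2 r)
     \int[lebesgue_measure]_(t in oball x.1 (halfchord (s - x.2))) (f (t, s))%:E)%E.
Proof.
move=> /integrable_disc fi.
rewrite integral_mkcond -integral21_prod_meas1; last first.
  exact: (@integrable_mkcond _ plane R mu2 _ (EFin \o f) measurable_disc).1.
rewrite [RHS]integral_mkcond; apply: eq_integral => s _.
rewrite /fubini_G /patch /=; case: ifPn; rewrite ?inE ?notin_setE/= => hs.
  rewrite [RHS]integral_mkcond; apply: eq_integral => t _.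
  rewrite /patch; congr (if _ then _ else _).
  by apply/idP/idP; rewrite !inE; [move=> /disc_chord2[]|move=> ?; apply/disc_chord2].
apply: integral0_eq => t _; rewrite ifF//.
by apply/negbTE; rewrite notin_setE => /disc_chord2[].
Qed.

Lemma integral_disc12 (f : R * R -> R) :
  (forall p, cdisc x r p -> {for p, continuous f}) ->
  (\int[mu2]_(y in disc x r) (f y)%:E =
   \int[lebesgue_measure]_(t in oball x.1 r)
     \int[lebesgue_measure]_(s in oball x.2 (halfchord (t - x.1))) (f (t, s))%:E)%E.
Proof.
move=> /integrable_disc fi.
rewrite integral_mkcond -integral12_prod_meas1; last first.
  exact: (@integrable_mkcond _ plane R mu2 _ (EFin \o f) measurable_disc).1.
rewrite [RHS]integral_mkcond; apply: eq_integral => t _.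
rewrite /fubini_F /patch /=; case: ifPn; rewrite ?inE ?notin_setE/= => ht.
  rewrite [RHS]integral_mkcond; apply: eq_integral => s _.
  rewrite /patch; congr (if _ then _ else _).
  by apply/idP/idP; rewrite !inE; [move=> /disc_chord1[]|move=> ?; apply/disc_chord1].
apply: integral0_eq => s _; rewrite ifF//.
by apply/negbTE; rewrite notin_setE => /disc_chord1[].
Qed.

End Disc.

(** * Green's identity on a disc *)

(** The integrand is the derivative of [P v' - P' v], which vanishes at both ends since [P] and [P']
    do. *)
Lemma integral_green_itv (R : realType) (a b : R) (P P1 P2 v v1 v2 : R -> R) :
  a < b ->
  (forall t, a <= t <= b -> [/\ is_derive t 1 P (P1 t), is_derive t 1 P1 (P2 t) &
    {for t, continuous P2}]) ->
  (forall t, a <= t <= b -> [/\ is_derive t 1 v (v1 t), is_derive t 1 v1 (v2 t) &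
    {for t, continuous v2}]) ->
  P a = 0 -> P b = 0 -> P1 a = 0 -> P1 b = 0 ->
  (\int[lebesgue_measure]_(t in `]a, b[) (P t * v2 t - P2 t * v t)%:E = 0)%E.
Proof.
move=> ab hP hv Pa Pb P1a P1b.
pose F t := P t * v1 t - P1 t * v t.
have dF t : a <= t <= b -> is_derive t 1 F (P t * v2 t - P2 t * v t).
  move=> tab; have [? ? _] := hP _ tab; have [? ? _] := hv _ tab.
  apply: is_derive_eq.
  rewrite /GRing.scale/=; ring.
have cF t : a <= t <= b -> {for t, continuous F}.
  by move=> /dF dFt; apply/differentiable_continuous/derivable1_diffP; exact: ex_derive.
have dc (f : R -> R) (d t : R) : is_derive t 1 f d -> {for t, continuous f}.
  by move=> h; apply/differentiable_continuous/derivable1_diffP; exact: ex_derive.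
have cf' t : a <= t <= b -> {for t, continuous (fun t => P t * v2 t - P2 t * v t)}.
  move=> tab; have [dP dP1 cP2] := hP _ tab; have [dv dv1 cv2] := hv _ tab.
  by apply: cvgB; apply: cvgM => //; apply: dc; eassumption.
have cf : {within `[a, b], continuous (fun t => P t * v2 t - P2 t * v t)}.
  by apply: continuous_in_subspaceT => t; rewrite inE/= in_itv/= => /cf'.
have abl : a <= a <= b by rewrite lexx ltW.
have abr : a <= b <= b by rewrite lexx ltW.
have := @continuous_FTC2 R _ F a b ab cf.
rewrite integral_itv_bndoo//; last first.
  apply/measurable_EFinP; apply: open_continuous_measurable_fun; first exact: interval_open.
  move=> t; rewrite inE/= in_itv/= => /andP[/ltW ta /ltW tb].
  by apply: cf'; rewrite ta.
move=> ->.
- by rewrite /F Pa Pb P1a P1b !mul0r subrr -EFinB subrr.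
- split.
  + by move=> t; rewrite in_itv/= => /andP[/ltW ta /ltW tb]; apply: ex_derive; apply: dF; rewrite ta.
  + exact/cvg_at_right_filter/cF.
  + exact/cvg_at_left_filter/cF.
- move=> t; rewrite in_itv/= => /andP[/ltW ta /ltW tb].
  by rewrite derive1E; apply: derive_val; apply: dF; rewrite ta.
Qed.

Lemma is_derive_chord_weight (R : realType) (c m r : R) (k : nat) (t : R) :
  let q z := c - (z - m) ^+ 2 / r ^+ 2 in
  is_derive t 1 (fun z => q z ^+ k.+1)
    (k.+1%:R * q t ^+ k * (- (2 * (t - m) / r ^+ 2))).
Proof.
move=> q; have dq : is_derive t 1 q (- (2 * (t - m) / r ^+ 2)).
  apply: is_derive_eq; rewrite /GRing.scale/=; ring.
have -> : (fun z => q z ^+ k.+1) = q ^+ k.+1 by apply/funext => z; rewrite fctE.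
apply: is_derive_eq; rewrite /GRing.scale/=; ring.
Qed.

(** Here [q] is the weight along a chord with midpoint [m], and [c] its value at [m]. The condition
    [h ^+ 2 = c * r ^+ 2] places the zeros of [q] at the ends of the chord. The factor of [v] is the
    second derivative of [q ^+ k.+2]; the exponent is at least 2, so the function and its first
    derivative both vanish there. *)
Lemma integral_green_chord (R : realType) (c m r h : R) (k : nat)
    (v v1 v2 : R -> R) :
  0 < r -> 0 < h -> h ^+ 2 = c * r ^+ 2 ->
  (forall t : R, m - h <= t <= m + h -> [/\ is_derive t 1 v (v1 t),
    is_derive t 1 v1 (v2 t) & {for t, continuous v2}]) ->
  let q t := c - (t - m) ^+ 2 / r ^+ 2 in
  (\int[lebesgue_measure]_(t in oball m h)
     (q t ^+ k.+2 * v2 t -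
      k.+2%:R * (k.+1%:R * q t ^+ k * (4 * ((t - m) ^+ 2 / r ^+ 2)) -
        2 * q t ^+ k.+1) / r ^+ 2 * v t)%:E = 0)%E.
Proof.
move=> r0 h0 hc hv q.
have r2 : r ^+ 2 != 0 by rewrite expf_neq0// gt_eqF.
have q0 t : (t - m) ^+ 2 = h ^+ 2 -> q t = 0.
  by move=> th; rewrite /q th hc mulfK// subrr.
have dq (j : nat) (t : R) : is_derive t 1 (fun z => q z ^+ j.+1)
    (j.+1%:R * q t ^+ j * (- (2 * (t - m) / r ^+ 2))).
  exact: is_derive_chord_weight.
pose P1 t := k.+2%:R * q t ^+ k.+1 * (- (2 * (t - m) / r ^+ 2)).
pose P2 t := k.+2%:R * (k.+1%:R * q t ^+ k * (4 * ((t - m) ^+ 2 / r ^+ 2)) -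
        2 * q t ^+ k.+1) / r ^+ 2.
have cq : continuous q.
  move=> t; apply: cvgB; first exact: cvg_cst.
  apply: cvgM; last exact: cvg_cst.
  apply: (@continuous_exprn _ _ (fun z : R => z - m) 2 t).
  by apply: cvgB; [exact: cvg_id|exact: cvg_cst].
have cqn j : continuous (fun t => q t ^+ j).
  by move=> t; apply: (@continuous_exprn _ _ q j t); exact: cq.
have cP2 : continuous P2.
  move=> t; apply: cvgM; last exact: cvg_cst.
  apply: cvgM; first exact: cvg_cst.
  apply: cvgB; last by apply: cvgM; [exact: cvg_cst|exact: cqn].
  apply: cvgM; first by apply: cvgM; [exact: cvg_cst|exact: cqn].
  apply: cvgM; first exact: cvg_cst.
  apply: cvgM; last exact: cvg_cst.
  apply: (@continuous_exprn _ _ (fun z : R => z - m) 2 t).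
  by apply: cvgB; [exact: cvg_id|exact: cvg_cst].
apply: (@integral_green_itv _ _ _ _ P1 P2 v v1) => //; first lra.
- move=> t _; split; [exact: dq| |exact: cP2].
  have := dq k t; rewrite /P1 => ?.
  apply: is_derive_eq; rewrite /GRing.scale/= /P2 exprS; field; exact: lt0r_neq0.
- by rewrite q0 ?expr0n//; ring.
- by rewrite q0 ?expr0n//; ring.
- by rewrite /P1 q0 ?expr0n ?mulr0 ?mul0r//; ring.
- by rewrite /P1 q0 ?expr0n ?mulr0 ?mul0r//; ring.
Qed.

Section DiscGreen.
Variable R : realType.
Let plane := (measurableTypeR R * measurableTypeR R)%type.
Let mu2 : {measure set plane -> \bar R} := @leb2 R.
Variables (x : R * R) (r : R).
Hypothesis r0 : 0 < r.

Lemma halfchord_gt0 c s : oball c r s -> 0 < halfchord r (s - c).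
Proof.
rewrite /oball/= in_itv/= sqrtr_gt0 subr_gt0 => /andP[? ?].
rewrite -subr_gt0 subr_sqr mulr_gt0//; lra.
Qed.

Lemma halfchord_sqr c s : oball c r s ->
  halfchord r (s - c) ^+ 2 = (1 - (s - c) ^+ 2 / r ^+ 2) * r ^+ 2.
Proof.
move=> cs; have := halfchord_gt0 cs; rewrite sqrtr_gt0 => /ltW h.
by rewrite sqr_sqrtr// mulrBl mul1r divfK// expf_neq0// gt_eqF.
Qed.

Lemma closed_chord (a b m : R) :
  m - halfchord r b <= a <= m + halfchord r b -> 0 < halfchord r b ->
  (a - m) ^+ 2 + b ^+ 2 <= r ^+ 2.
Proof.
move=> /andP[h1 h2] h0; have : (a - m) ^+ 2 <= halfchord r b ^+ 2.
  rewrite -subr_ge0 subr_sqr mulr_ge0//; lra.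
by rewrite sqr_sqrtr; [lra|apply: ltW; rewrite -sqrtr_gt0].
Qed.

Lemma weight_chord1 (t s : R) : weight x r (t, s) =
  1 - (s - x.2) ^+ 2 / r ^+ 2 - (t - x.1) ^+ 2 / r ^+ 2.
Proof. by rewrite /weight/=; ring. Qed.

Lemma weight_chord2 (t s : R) : weight x r (t, s) =
  1 - (t - x.1) ^+ 2 / r ^+ 2 - (s - x.2) ^+ 2 / r ^+ 2.
Proof. by rewrite /weight/=; ring. Qed.

Variables (D : set (R * R)) (u : R * R -> R).
Hypotheses (xrD : cdisc x r `<=` D) (uC2 : C2_on D u).

Let w := weight x r.

Let continuous_section1 (g : R * R -> R) t s :
  {for (t, s), continuous g} -> {for t, continuous (fun z => g (z, s))}.
Proof.
move=> cg; apply: (@continuous_comp _ _ _ (fun z => (z, s)) g) => //.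
by apply: (@cvg_pair _ _ _ _ (nbhs t) (nbhs s)); [exact: cvg_id|exact: cvg_cst].
Qed.

Let continuous_section2 (g : R * R -> R) t s :
  {for (t, s), continuous g} -> {for s, continuous (fun z => g (t, z))}.
Proof.
move=> cg; apply: (@continuous_comp _ _ _ (fun z => (t, z)) g) => //.
by apply: (@cvg_pair _ _ _ _ (nbhs t) (nbhs s)); [exact: cvg_cst|exact: cvg_id].
Qed.

(* Second derivative of [w ^+ k.+2] in a coordinate direction along which the
   displacement from the centre is [d]. *)
Definition weight_pd2 (k : nat) (d : R) (y : R * R) : R :=
  k.+2%:R * (k.+1%:R * w y ^+ k * (4 * (d ^+ 2 / r ^+ 2)) -
    2 * w y ^+ k.+1) / r ^+ 2.

Let continuous_weightX n : continuous (fun y => w y ^+ n).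
Proof.
by move=> y; apply: (@continuous_exprn _ _ w n y); exact: continuous_weight.
Qed.

Let continuous_weight_pd2 k (c : R) (g : R * R -> R) :
  continuous g -> continuous (fun y => weight_pd2 k (g y - c) y).
Proof.
move=> cg y; apply: cvgM; last exact: cvg_cst.
apply: cvgM; first exact: cvg_cst.
apply: cvgB; last by apply: cvgM; [exact: cvg_cst|exact: continuous_weightX].
apply: cvgM; first by apply: cvgM; [exact: cvg_cst|exact: continuous_weightX].
apply: cvgM; first exact: cvg_cst.
apply: cvgM; last exact: cvg_cst.
apply: (@continuous_exprn _ _ (fun z => g z - c) 2 y).
by apply: cvgB; [exact: cg|exact: cvg_cst].
Qed.

Lemma continuous_green1 k p : cdisc x r p -> {for p, continuous
  (fun y => w y ^+ k.+2 * pd1 (pd1 u) y - weight_pd2 k (y.1 - x.1) y * u y)}.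
Proof.
move=> /xrD Dp; have [[cu _] [[_ [_ cu1]] _]] := uC2.
apply: cvgB; apply: cvgM.
- exact: continuous_weightX.
- exact: (cu1 _ Dp).1.
- apply: (@continuous_weight_pd2 k x.1 fst) => z; exact: cvg_fst.
- exact: cu.
Qed.

Lemma continuous_green2 k p : cdisc x r p -> {for p, continuous
  (fun y => w y ^+ k.+2 * pd2 (pd2 u) y - weight_pd2 k (y.2 - x.2) y * u y)}.
Proof.
move=> /xrD Dp; have [[cu _] [_ [_ [_ cu1]]]] := uC2.
apply: cvgB; apply: cvgM.
- exact: continuous_weightX.
- exact: (cu1 _ Dp).2.
- apply: (@continuous_weight_pd2 k x.2 snd) => z; exact: cvg_snd.
- exact: cu.
Qed.

(** The inner integral already vanishes on every horizontal chord. Closed chords lie in the closed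
    disc, hence in [D], so [u] is regular up to their ends. *)
Lemma integral_green1 k :
  (\int[mu2]_(y in disc x r) (w y ^+ k.+2 * pd1 (pd1 u) y -
     weight_pd2 k (y.1 - x.1) y * u y)%:E = 0)%E.
Proof.
rewrite integral_disc21//; last exact: continuous_green1.
rewrite integral0_eq// => s xs.
have h0 := halfchord_gt0 xs.
have <- := @integral_green_chord _ _ x.1 _ _ k (fun t => u (t, s))
  (fun t => pd1 u (t, s)) (fun t => pd1 (pd1 u) (t, s)) r0 h0 (halfchord_sqr xs).
  apply: eq_integral => t _; rewrite /weight_pd2 /=.
  by rewrite /w weight_chord1.
move=> t /closed_chord => /(_ h0) ts.
have /xrD Dp : cdisc x r (t, s).
  by apply/cdiscP => //; rewrite /weight subr_ge0 ler_pdivrMr ?exprn_gt0// mul1r.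
have [[_ [du _]] [[_ [du1 cu1]] _]] := uC2.
split.
- by have [/derivableP + _] := du _ Dp; rewrite -derive1E.
- by have [/derivableP + _] := du1 _ Dp; rewrite -derive1E.
- exact: (@continuous_section1 (pd1 (pd1 u)) t s (cu1 _ Dp).1).
Qed.

Lemma integral_green2 k :
  (\int[mu2]_(y in disc x r) (w y ^+ k.+2 * pd2 (pd2 u) y -
     weight_pd2 k (y.2 - x.2) y * u y)%:E = 0)%E.
Proof.
rewrite integral_disc12//; last exact: continuous_green2.
rewrite integral0_eq// => t xt.
have h0 := halfchord_gt0 xt.
have <- := @integral_green_chord _ _ x.2 _ _ k (fun s => u (t, s))
  (fun s => pd2 u (t, s)) (fun s => pd2 (pd2 u) (t, s)) r0 h0 (halfchord_sqr xt).
  apply: eq_integral => s _; rewrite /weight_pd2 /=.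
  by rewrite /w weight_chord2.
move=> s /closed_chord => /(_ h0) ts.
have /xrD Dp : cdisc x r (t, s).
  apply/cdiscP => //; rewrite /weight subr_ge0 ler_pdivrMr ?exprn_gt0// mul1r.
  by rewrite addrC.
have [[_ [du _]] [_ [_ [du2 cu2]]]] := uC2.
split.
- by have [_ /derivableP +] := du _ Dp; rewrite -derive1E.
- by have [_ /derivableP +] := du2 _ Dp; rewrite -derive1E.
- exact: (@continuous_section2 (pd2 (pd2 u)) t s (cu2 _ Dp).2).
Qed.

End DiscGreen.

(** * Weighted moments *)

Section Moments.
Variable R : realType.
Let plane := (measurableTypeR R * measurableTypeR R)%type.
Let mu2 : {measure set plane -> \bar R} := @leb2 R.
Variables (x : R * R) (r : R).
Hypothesis r0 : 0 < r.

Let J (f : R * R -> R) : R := Rintegral mu2 (disc x r) f.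

Let contd (f : R * R -> R) := forall p, cdisc x r p -> {for p, continuous f}.

Let contdM f g : contd f -> contd g -> contd (fun y => f y * g y).
Proof. by move=> cf cg p xp; apply: cvgM; [exact: cf|exact: cg]. Qed.

Let contdZ a f : contd f -> contd (fun y => a * f y).
Proof. by move=> cf p xp; apply: cvgM; [exact: cvg_cst|exact: cf]. Qed.

Let contdD f g : contd f -> contd g -> contd (fun y => f y + g y).
Proof. by move=> cf cg p xp; apply: cvgD; [exact: cf|exact: cg]. Qed.

Let contd_weightX k : contd (fun y => weight x r y ^+ k).
Proof.
move=> p _; apply: (@continuous_exprn _ _ (weight x r) k p).
exact: continuous_weight.
Qed.

Let JZ a f : contd f -> J (fun y => a * f y) = a * J f.
Proof.
by move=> cf; rewrite /J RintegralZl//; [exact: measurable_disc|exact: integrable_disc].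
Qed.

Let JD f g : contd f -> contd g -> J (fun y => f y + g y) = J f + J g.
Proof.
move=> cf cg; rewrite /J RintegralD//; first exact: measurable_disc.
  exact: integrable_disc.
exact: integrable_disc.
Qed.

Let J3 a b c f g h : contd f -> contd g -> contd h ->
  J (fun y => a * f y + (b * g y + c * h y)) = a * J f + (b * J g + c * J h).
Proof.
move=> cf cg ch.
transitivity (J (fun y => a * f y) + J (fun y => b * g y + c * h y)).
  by apply: JD; [exact: contdZ|apply: contdD; exact: contdZ].
rewrite JZ//; congr (_ + _).
by rewrite -!JZ//; apply: JD; exact: contdZ.
Qed.

Let J_le f g : contd f -> contd g -> (forall y, disc x r y -> f y <= g y) -> J f <= J g.
Proof.
move=> cf cg fg; apply: le_Rintegral => //; first exact: measurable_disc.
  exact: integrable_disc.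
exact: integrable_disc.
Qed.

Definition moment (u : R * R -> R) (k : nat) := J (fun y => weight x r y ^+ k * u y).

(** With [n = k + 2], [|grad w|^2 = 4 (1 - w) / r^2] and [laplacian w = - 4 / r^2] give [laplacian
    (w^n) = (4 n / r^2) ((n-1) w^(n-2) - n w^(n-1))], again a combination of powers of [w]. The
    eigenvalue [m] is kept general because [m = 0], [u = 1] yields the moments of constants. *)
Lemma moment_rec (D : set (R * R)) (u : R * R -> R) (m : R) (k : nat) :
  cdisc x r `<=` D -> C2_on D u ->
  (forall y, D y -> laplacian u y = m * u y) ->
  m * r ^+ 2 * moment u k.+2 =
  4 * k.+2%:R * (k.+1%:R * moment u k - k.+2%:R * moment u k.+1).
Proof.
move=> xrD uC2 um.
have cu : contd u by move=> p /xrD; case: uC2 => -[cu _] _; exact: cu.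
pose G1 y := weight x r y ^+ k.+2 * pd1 (pd1 u) y - weight_pd2 x r k (y.1 - x.1) y * u y.
pose G2 y := weight x r y ^+ k.+2 * pd2 (pd2 u) y - weight_pd2 x r k (y.2 - x.2) y * u y.
have cG1 : contd G1 by move=> p xp; exact: (@continuous_green1 _ _ _ _ _ xrD uC2 k p xp).
have cG2 : contd G2 by move=> p xp; exact: (@continuous_green2 _ _ _ _ _ xrD uC2 k p xp).
have J1 : J G1 = 0.
  by rewrite /J /Rintegral /G1 (integral_green1 r0 xrD uC2 k).
have J2 : J G2 = 0.
  by rewrite /J /Rintegral /G2 (integral_green2 r0 xrD uC2 k).
pose c := 4 * k.+2%:R / r ^+ 2.
have rn0 : r != 0 by exact: lt0r_neq0.
have cw n : contd (fun y => weight x r y ^+ n * u y) by exact: contdM.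
have : m * moment u k.+2 + (- (c * k.+1%:R) * moment u k +
    c * k.+2%:R * moment u k.+1) = 0.
  rewrite /moment -J3//.
  rewrite -[RHS](addr0 0) -[X in _ = X + _]J1 -J2 -JD//.
  apply: eq_Rintegral => y; rewrite inE => xy.
  have : pd1 (pd1 u) y + pd2 (pd2 u) y = m * u y by apply: um; exact/xrD/disc_cdisc.
  move=> /eqP; rewrite eq_sym -subr_eq => /eqP um2.
  (* In the sum of the two directional identities the squared displacements enter only through their
     sum, so this substitution leaves powers of the weight alone. *)
  have e : (y.1 - x.1) ^+ 2 / r ^+ 2 = 1 - weight x r y - (y.2 - x.2) ^+ 2 / r ^+ 2.
    by rewrite /weight; ring.
  rewrite /G1 /G2 /weight_pd2 e -um2 /c [_ ^+ k.+2]exprS [_ ^+ k.+1]exprS.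
  rewrite -!natr1; field; exact: rn0.
move=> /(congr1 ( *%R (r ^+ 2))); rewrite mulr0 => h.
apply/eqP; rewrite -subr_eq0 -h; apply/eqP.
by rewrite /c; field; exact: rn0.
Qed.

(** The term [0 * cst 1 y] pads the integrand to the three-term shape of [J3]. *)
Let momentD_cst1 a b k :
  J (fun y => a * (weight x r y ^+ k * cst 1 y) + (b * (weight x r y ^+ k.+1 * cst 1 y)
    + 0 * cst 1 y)) = a * moment (cst 1) k + b * moment (cst 1) k.+1.
Proof.
have c1 : contd (cst 1) by move=> p _; exact: cvg_cst.
by rewrite J3 ?mul0r ?addr0//; exact: contdM.
Qed.

(** Since [w^k >= 0] on the disc, a bound on [u] affine in [w] becomes a bound by two consecutive
    moments of 1, which are known explicitly. *)
Lemma moment_le (u : R * R -> R) a b k : contd u ->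
  (forall y, disc x r y -> u y <= a + b * weight x r y) ->
  moment u k <= a * moment (cst 1) k + b * moment (cst 1) k.+1.
Proof.
move=> cu uab; have c1 : contd (cst 1) by move=> p _; exact: cvg_cst.
rewrite -momentD_cst1; apply: J_le.
- exact: contdM.
- apply: contdD; first by apply: contdZ; exact: contdM.
  by apply: contdD; [apply: contdZ; exact: contdM|exact: contdZ].
- move=> y xy; have /ltW w0 := (discP x r0 y).1 xy.
  apply: le_trans (ler_wpM2l (exprn_ge0 k w0) (uab y xy)) _.
  by rewrite exprS le_eqVlt; apply/orP; left; apply/eqP => /=; ring.
Qed.

Lemma moment_ge (u : R * R -> R) a b k : contd u ->
  (forall y, disc x r y -> a + b * weight x r y <= u y) ->
  a * moment (cst 1) k + b * moment (cst 1) k.+1 <= moment u k.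
Proof.
move=> cu uab; have c1 : contd (cst 1) by move=> p _; exact: cvg_cst.
rewrite -momentD_cst1; apply: J_le.
- apply: contdD; first by apply: contdZ; exact: contdM.
  by apply: contdD; [apply: contdZ; exact: contdM|exact: contdZ].
- exact: contdM.
- move=> y xy; have /ltW w0 := (discP x r0 y).1 xy.
  apply: le_trans (ler_wpM2l (exprn_ge0 k w0) (uab y xy)).
  by rewrite exprS le_eqVlt; apply/orP; left; apply/eqP => /=; ring.
Qed.

Lemma continuous_weight_sum (u : R * R -> R) n : contd u ->
  contd (fun y => (\sum_(k < n) weight x r y ^+ k.+1 / k.+1%:R) * u y).
Proof.
move=> cu; apply: contdM => //; elim: n => [|n ih].
  have -> : (fun y => \sum_(k < 0) weight x r y ^+ k.+1 / k.+1%:R) = cst 0.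
    by apply/funext => y; rewrite big_ord0.
  by move=> p _; exact: cvg_cst.
have -> : (fun y => \sum_(k < n.+1) weight x r y ^+ k.+1 / k.+1%:R) =
    (fun y => \sum_(k < n) weight x r y ^+ k.+1 / k.+1%:R +
              n.+1%:R^-1 * weight x r y ^+ n.+1).
  by apply/funext => y; rewrite big_ord_recr/= [n.+1%:R^-1 * _]mulrC.
by apply: contdD => //; exact: contdZ.
Qed.

Lemma integral_weight_sum (u : R * R -> R) n : contd u ->
  J (fun y => (\sum_(k < n) weight x r y ^+ k.+1 / k.+1%:R) * u y) =
  \sum_(k < n) moment u k.+1 / k.+1%:R.
Proof.
move=> cu; elim: n => [|n ih].
  rewrite big_ord0; transitivity (J (fun y => 0 * u y)); last by rewrite JZ ?mul0r.
  by apply: eq_Rintegral => y _; rewrite big_ord0.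
rewrite big_ord_recr/= -ih mulrC -JZ; last exact: contdM.
rewrite -JD; last 2 first.
- exact: continuous_weight_sum.
- by apply: contdZ; exact: contdM.
by apply: eq_Rintegral => y _; rewrite big_ord_recr/=; ring.
Qed.

End Moments.

(** * Area of the disc and moments of the constant 1 *)

(** A primitive is [a (t + sin t cos t)]. With [a = r^2] this is the area integral after the
    substitution [s = c + r sin t]. *)
Lemma integral_cos2 (R : realType) (a : R) :
  (\int[lebesgue_measure]_(t in `[(- (pi / 2))%R, (pi / 2)%R]) (2 * a * cos t ^+ 2)%:E =
   (a * pi)%:E)%E.
Proof.
pose F (t : R) := a * (t + sin t * cos t).
have dF (t : R) : is_derive t 1 F (2 * a * cos t ^+ 2).
  have : is_derive t 1 (a \*: ((@id R) + sin * cos)) (2 * a * cos t ^+ 2).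
    apply: is_derive_eq; rewrite /GRing.scale/=.
    have := cos2Dsin2 t; move=> h; rewrite -[X in X + _]h; ring.
  by [].
have cF (t : R) : {for t, continuous F}.
  by apply/differentiable_continuous/derivable1_diffP; exact: (@ex_derive _ _ _ _ _ _ _ (dF t)).
have p0 : 0 < pi :> R := pi_gt0 R.
rewrite (@continuous_FTC2 R _ F).
- by rewrite /F sinN cosN sin_pihalf cos_pihalf -EFinB; congr EFin; field.
- lra.
- apply: continuous_subspaceT => t; apply: cvgM; first exact: cvg_cst.
  by apply: (@continuous_exprn _ _ cos 2 t); exact: continuous_cos.
- split=> [t _| |]; first exact: (@ex_derive _ _ _ _ _ _ _ (dF t)).
  + exact/cvg_at_right_filter/cF.
  + exact/cvg_at_left_filter/cF.
- by move=> t _; rewrite derive1E; apply: derive_val; exact: dF.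
Qed.

Lemma lebesgue_measure_oball (R : realType) (c h : R) : 0 < h ->
  lebesgue_measure (oball c h) = (2 * h)%:E.
Proof.
move=> h0; rewrite /oball lebesgue_measure_itv /= lte_fin ifT; last by lra.
by rewrite -EFinB; congr EFin; ring.
Qed.

Section DiscArea.
Variable R : realType.
Variables (x : R * R) (r : R).
Hypothesis r0 : 0 < r.

Let continuous_halfchord : continuous (halfchord r).
Proof.
move=> s; rewrite /continuous_at /halfchord.
apply: (@continuous_comp _ _ _ (fun z : R => r ^+ 2 - z ^+ 2) Num.sqrt s).
  by apply: cvgB; [exact: cvg_cst|exact: exprn_continuous].
exact: sqrt_continuous.
Qed.

Let integral_halfchord (c : R) :
  (\int[lebesgue_measure]_(s in oball c r) (2 * halfchord r (s - c))%:E =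
   (pi * r ^+ 2)%:E)%E.
Proof.
have p0 : 0 < pi :> R := pi_gt0 R.
pose F t : R := c + r * sin t.
pose G s : R := 2 * halfchord r (s - c).
have dF (t : R) : is_derive t 1 F (r * cos t).
  have : is_derive t 1 (cst c + r \*: sin) (r * cos t).
    by apply: is_derive_eq; rewrite /GRing.scale/=; ring.
  by [].
have cF (t : R) : {for t, continuous F}.
  by apply/differentiable_continuous/derivable1_diffP; exact: (@ex_derive _ _ _ _ _ _ _ (dF t)).
have F'E : F^`()%classic = (fun t => r * cos t).
  by apply/funext => t; rewrite derive1E; apply: derive_val; exact: dF.
have cF' : continuous (fun t : R => r * cos t).
  by move=> t; apply: cvgM; [exact: cvg_cst|exact: continuous_cos].
have cG : continuous G.
  move=> s; apply: cvgM; first exact: cvg_cst.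
  apply: (@continuous_comp _ _ _ (fun z => z - c) (halfchord r) s).
    by apply: cvgB; [exact: cvg_id|exact: cvg_cst].
  exact: continuous_halfchord.
have Fa : F (- (pi / 2)) = c - r by rewrite /F sinN sin_pihalf mulrN1.
have Fb : F (pi / 2) = c + r by rewrite /F sin_pihalf mulr1.
rewrite -(@integral_itv_bndoo _ _ _ _ true false); last first.
  apply/measurable_EFinP; apply: measurable_funTS.
  exact: continuous_measurable_fun.
rewrite -Fa -Fb (@integration_by_substitution_increasing _ F G); first last.
- exact: continuous_subspaceT.
- split=> [t _| |]; first exact: (@ex_derive _ _ _ _ _ _ _ (dF t)).
  + exact/cvg_at_right_filter/cF.
  + exact/cvg_at_left_filter/cF.
- by rewrite F'E; apply/cvg_ex; eexists; apply: cvg_at_left_filter; exact: cF'.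
- by rewrite F'E; apply/cvg_ex; eexists; apply: cvg_at_right_filter; exact: cF'.
- by rewrite F'E => t _; exact: cF'.
- by move=> s t sI tI st; rewrite /F ltrD2l ltr_pM2l// ltr_sin.
- lra.
rewrite (_ : pi * r ^+ 2 = r ^+ 2 * pi); last exact: mulrC.
rewrite -integral_cos2 F'E.
apply: eq_integral => t; rewrite inE/= in_itv/= => tI.
have c0 := cos_ge0_pihalf tI.
congr EFin; rewrite fctE /G /F /halfchord /= addrAC subrr add0r exprMn.
(* Under the root stands [r^2 - (r sin t)^2 = (r cos t)^2]; as [cos t >= 0] on the interval, the
   half chord is [r cos t]. *)
rewrite -[X in X - _]mulr1 -mulrBr -cos2sin2 -exprMn sqrtr_sqr.
by rewrite ger0_norm ?mulr_ge0 ?(ltW r0)//; ring.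
Qed.

Lemma moment_cst1_0 : moment x r (cst 1) 0 = pi * r ^+ 2.
Proof.
rewrite /moment /Rintegral.
have -> : (fun y : R * R => (weight x r y ^+ 0 * cst 1 y)%:E) = (fun y => (cst 1 y)%:E).
  by apply/funext => y; rewrite expr0 mul1r.
rewrite (integral_disc21 r0); last by move=> p _; exact: cvg_cst.
rewrite -[RHS]/(fine (pi * r ^+ 2)%:E) -(integral_halfchord x.2).
congr fine; apply: eq_integral => s; rewrite inE => xs.
transitivity (1%:E * lebesgue_measure (oball x.1 (halfchord r (s - x.2))))%E.
  exact: (@integral_cst _ (measurableTypeR R) R (@lebesgue_measure R) _
    (measurable_itv _) 1%:E).
by rewrite lebesgue_measure_oball ?mul1e//; exact: halfchord_gt0.
Qed.

(** The constant 1 is harmonic, so the recurrence with eigenvalue 0 says that [(k+1) M_k] does not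
    depend on [k]; at [k = 0] it is the area. *)
Lemma moment_cst1 k : moment x r (cst 1) k = pi * r ^+ 2 / k.+1%:R.
Proof.
have d1 (c : R) : derive1 (fun _ : R => c) = cst 0.
  by apply/funext => t; rewrite derive1_cst.
have p1 (c : R) : pd1 (cst c : R * R -> R) = cst 0.
  by apply/funext => p; rewrite /pd1 d1.
have p2 (c : R) : pd2 (cst c : R * R -> R) = cst 0.
  by apply/funext => p; rewrite /pd2 d1.
have C1 (c : R) : C1_on setT (cst c : R * R -> R).
  rewrite /C1_on p1 p2; split; first by move=> p _; exact: cvg_cst.
  split=> p _; first by split; exact: derivable_cst.
  by split; exact: cvg_cst.
have C2 : C2_on setT (cst 1 : R * R -> R) by rewrite /C2_on p1 p2.
have rec j : j.+2%:R * moment x r (cst 1) j.+1 = j.+1%:R * moment x r (cst 1) j.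
  have := @moment_rec R x r r0 setT (cst 1) 0 j (fun _ _ => I) C2.
  rewrite !mul0r => /(_ _)/esym/eqP.
  rewrite mulf_eq0 mulf_eq0 !pnatr_eq0/= subr_eq0 => h.
  by apply/esym/eqP/h => y _; rewrite /laplacian p1 p2 p1 p2 mul0r addr0.
elim: k => [|k ih]; first by rewrite moment_cst1_0 divr1.
have := rec k; rewrite ih [k.+1%:R * _]mulrC divfK ?pnatr_eq0// => <-.
by rewrite mulrC mulKf ?pnatr_eq0.
Qed.

End DiscArea.

(** * Concentration of the weights at the centre *)

Section MomentLimit.
Variable R : realType.
Variables (x : R * R) (r : R).
Hypothesis r0 : 0 < r.

(* Away from [x], [1 - weight] is bounded below, so it absorbs the oscillation of [u]. *)
Lemma oscillation_weight (u : R * R -> R) (e : R) :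
  (forall p, cdisc x r p -> {for p, continuous u}) -> 0 < e ->
  exists2 C, 0 <= C & forall y, disc x r y ->
    `|u y - u x| <= e + C * (1 - weight x r y).
Proof.
move=> cu e0; have [M M0 uM] := continuous_cdisc_bounded r0 cu.
have xx : cdisc x r x by apply/cdiscP => //; rewrite /weight !subrr expr0n addr0 mul0r subr0.
have /cvgrPdist_lt /(_ _ e0) /nbhs_ballP[d /= d0 dP] := cu x xx.
have C0 : 0 <= 2 * M * (r ^+ 2 / d ^+ 2).
  by apply: mulr_ge0; [apply: mulr_ge0|apply: divr_ge0; exact: sqr_ge0].
exists (2 * M * (r ^+ 2 / d ^+ 2)) => //.
move=> y xy; have w1 : 0 <= 1 - weight x r y by rewrite subr_ge0 weight_le1.
have [|] := pselect (ball x d y) => [/dP uxy|nxy].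
  rewrite distrC (le_trans (ltW uxy))// lerDl.
  exact: mulr_ge0.
(* [ball] is a square here: outside it some coordinate is at least [d] away from that of [x]. The
   chosen constant times [d^2 / r^2] is [2 M], which bounds the oscillation of [u]. *)
have dw : d ^+ 2 / r ^+ 2 <= 1 - weight x r y.
  rewrite /weight opprB addrC subrK ler_pM2r ?invr_gt0 ?exprn_gt0//.
  have sq (s : R) : d <= `|s| -> d ^+ 2 <= s ^+ 2.
    by move=> ds; rewrite -[s ^+ 2]real_normK ?num_real// ler_sqr ?nnegrE// ltW.
  apply: contrapT => /negP; rewrite -ltNge => dlt; apply: nxy.
  by split; rewrite /ball/= ltNge distrC; apply/negP => /sq;
    rewrite leNgt => /negP; apply; apply: le_lt_trans dlt; rewrite ?lerDl ?lerDr sqr_ge0.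
apply: (@le_trans _ _ (M + M)).
  by rewrite (le_trans (ler_normB _ _))// lerD ?uM//; exact: disc_cdisc.
apply: (@le_trans _ _ (2 * M * (r ^+ 2 / d ^+ 2) * (d ^+ 2 / r ^+ 2))).
  have rn0 := lt0r_neq0 r0; have dn0 := lt0r_neq0 d0.
  rewrite le_eqVlt; apply/orP; left; apply/eqP; field.
  by rewrite rn0 dn0.
apply: (@le_trans _ _ (2 * M * (r ^+ 2 / d ^+ 2) * (1 - weight x r y))).
  exact: ler_wpM2l.
by rewrite lerDr ltW.
Qed.

(** [(k+1) w^k / (pi r^2)] is a probability density on the disc, under which [1 - w] has mean
    [1 / (k+2)]. The oscillation bound therefore leaves an error of at most [e / 2 + C / (k+2)]. *)
Lemma moment_cvg (u : R * R -> R) :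
  (forall p, cdisc x r p -> {for p, continuous u}) ->
  (fun k => k.+1%:R * moment x r u k / (pi * r ^+ 2)) @ \oo --> u x.
Proof.
move=> cu; apply/cvgrPdist_le => /= e e0.
have e2 : 0 < e / 2 by lra.
have [C C0 uC] := oscillation_weight cu e2.
near=> k.
have A0 : 0 < pi * r ^+ 2 :> R by rewrite mulr_gt0 ?pi_gt0 ?exprn_gt0.
have An0 := lt0r_neq0 A0.
have kC : C / k.+2%:R <= e / 2.
  rewrite ler_pdivrMr// -ler_pdivrMl//.
  apply: (@le_trans _ _ k%:R); last by rewrite ler_nat ltnW.
  by apply: ltW; near: k; exact: nbhs_infty_gtr.
have k1 : (k.+1%:R : R) != 0 by rewrite pnatr_eq0.
have k2 : (k.+2%:R : R) != 0 by rewrite pnatr_eq0.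
have E a b : k.+1%:R * (a * moment x r (cst 1) k + b * moment x r (cst 1) k.+1) /
    (pi * r ^+ 2) = a + b - b / k.+2%:R.
  rewrite !moment_cst1//; move: An0 k1 k2; set A := pi * r ^+ 2 => An0 k1 k2.
  have -> : (k.+2%:R : R) = k.+1%:R + 1 by rewrite natr1.
  rewrite -[k.+2%:R]natr1 in k2; move: k1 k2; move: (k.+1%:R : R) => n k1 k2.
  by field; rewrite An0 k1 k2.
have up : moment x r u k <= (u x + e / 2 + C) * moment x r (cst 1) k +
    (- C) * moment x r (cst 1) k.+1.
  apply: moment_le => // y /uC; rewrite ler_norml => /andP[_].
  lra.
have lo : (u x - e / 2 - C) * moment x r (cst 1) k + C * moment x r (cst 1) k.+1
    <= moment x r u k.
  apply: moment_ge => // y /uC; rewrite ler_norml => /andP[+ _].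
  lra.
have mono s t : s <= t -> k.+1%:R * s / (pi * r ^+ 2) <= k.+1%:R * t / (pi * r ^+ 2).
  by move=> st; rewrite ler_pM2r ?invr_gt0// ler_wpM2l.
move: (mono _ _ up) (mono _ _ lo); rewrite !E mulNr ler_norml.
move: kC; move: (C / _) (_ * moment _ _ _ _ / _) => q v qe h1 h2.
by apply/andP; split; lra.
Unshelve. all: by end_near.
Qed.

End MomentLimit.

(** * The recurrence for Bessel functions *)

Section BesselRecurrence.
Variable R : realType.

(* Summing the recurrence from [n] on, a bound [B] on the tail improves to
   [z B / n.+1], hence to [B / 2] for [n] large. *)
Lemma recurrence_null (z : R) (d : nat -> R) :
  (forall n, d n = d n.+1 + z * d n.+2 / (n.+1%:R * n.+2%:R)) ->
  d @ \oo --> (0 : R) -> forall n, d n = 0.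
Proof.
move=> rec d0.
have [n0 zn0 dn0] : exists2 n0 : nat, 2 * `|z| <= n0.+1%:R &
    forall n, (n0 <= n)%N -> `|d n| <= 1.
  have /cvgrPdist_le/(_ _ ltr01)[N _ dN] := d0.
  have [K _ zK] := nbhs_infty_gtr (2 * `|z|).
  exists (maxn N K); last first.
    move=> n nN; have := dN n; rewrite /= sub0r normrN; apply.
    by apply: leq_trans nN; exact: leq_maxl.
  have /ltW/le_trans := zK (maxn N K) (leq_maxr _ _); apply.
  by rewrite ler_nat.
have half B : (forall n, (n0 <= n)%N -> `|d n| <= B) ->
    forall n, (n0 <= n)%N -> `|d n| <= B / 2.
  move=> dB n nn0.
  have B0 : 0 <= B by apply: le_trans (dB _ nn0).
  (* The coefficients [1 / ((p+1) (p+2))] telescope, so the accumulated error stays below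
     [|z| B / (n+1)] for every [m], while [d (n + m)] tends to 0. *)
  have tele m : `|d n| <= `|d (n + m)%N| +
      `|z| * B * (n.+1%:R^-1 - (n + m).+1%:R^-1).
    elim: m => [|m ih]; first by rewrite addn0 subrr mulr0 addr0.
    apply: le_trans ih _; set p := (n + m)%N.
    have -> : `|z| * B * (n.+1%:R^-1 - (n + m.+1).+1%:R^-1) =
        `|z| * B * (p.+1%:R^-1 - p.+2%:R^-1) + `|z| * B * (n.+1%:R^-1 - p.+1%:R^-1).
      by rewrite addnS -/p; ring.
    rewrite addrA lerD2r [in leLHS]rec addnS -/p.
    apply: le_trans (ler_normD _ _) _; rewrite lerD2l.
    rewrite normrM normrM normfV.
    have -> : p.+1%:R^-1 - p.+2%:R^-1 = (p.+1%:R * p.+2%:R)^-1 :> R.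
      have h1 : (p.+1%:R : R) != 0 by rewrite pnatr_eq0.
      have h2 : (p.+2%:R : R) != 0 by rewrite pnatr_eq0.
      move: h1 h2; rewrite -[p.+2%:R]natr1; move: (p.+1%:R : R) => q h1 h2.
      by field; rewrite h1 h2.
    rewrite [X in _ / X]ger0_norm ?mulr_ge0// ler_pM2r ?invr_gt0 ?mulr_gt0//.
    by rewrite ler_wpM2l// dB// /p; apply: leq_trans nn0 _; lia.
  apply/ler_addgt0Pr => e e0.
  have /cvgrPdist_le/(_ _ e0)[N _ dN] := d0.
  apply: le_trans (tele N) _; rewrite [leRHS]addrC lerD//.
    by have := dN (n + N)%N; rewrite /= sub0r normrN; apply; exact: leq_addl.
  apply: (@le_trans _ _ (`|z| * B / n.+1%:R)).
    by rewrite ler_wpM2l ?mulr_ge0// gerDl oppr_le0 invr_ge0.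
  have zn : 2 * `|z| <= n.+1%:R by apply: le_trans zn0 _; rewrite ler_nat; lia.
  rewrite ler_pdivrMr//; move: zn; move: (n.+1%:R : R) `|z| => q y; nra.
have dpow j n : (n0 <= n)%N -> `|d n| <= (1 / 2) ^+ j.
  elim: j n => [|j ih] n nn0; first by rewrite expr0 dn0.
  by rewrite exprS mulrC mulrA mulr1; exact: half _ ih n nn0.
have dz n : (n0 <= n)%N -> d n = 0.
  move=> nn0; apply/eqP; rewrite -normr_eq0 eq_le normr_ge0 andbT.
  have : (fun j => (1 / 2 : R) ^+ j) @ \oo --> 0.
    by apply: cvg_expr; rewrite ger0_norm; lra.
  move=> c; apply: (cvgr_to_ge c); apply: nearW => j; exact: dpow.
(* Each term is determined by the next two, so vanishing propagates from the tail down to index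
   0. *)
suff dj j n : (n0 - n <= j)%N -> d n = 0 by move=> n; apply: (dj n0); lia.
elim: j n => [|j ih] n nj; first by apply: dz; lia.
have d1 : d n.+1 = 0 by apply: ih; lia.
have d2 : d n.+2 = 0 by apply: ih; lia.
by rewrite rec d1 d2 mulr0 mul0r addr0.
Qed.

(** Term of degree [k] of [0F1(; n+1; z)]: the Pochhammer symbol [(n+1)_k] is [(n+k)! / n!]. *)
Definition hyp0F1_term (z : R) (n k : nat) : R := z ^+ k * n`!%:R / (k`!%:R * (n + k)`!%:R).

Lemma hyp0F1_term0 z n : hyp0F1_term z n 0 = 1.
Proof. by rewrite /hyp0F1_term addn0 expr0 !mul1r divff// pnatr_eq0 -lt0n fact_gt0. Qed.

(** Contiguous relation, degree by degree. With [j = k + 1] it rests on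
    [1/(n+1)_j - 1/(n+2)_j = j / (n+1)_(j+1)], where the factor [j] turns [1/j!] into [1/k!]. *)
Lemma hyp0F1_termS z n k :
  hyp0F1_term z n k.+1 = hyp0F1_term z n.+1 k.+1 + z * hyp0F1_term z n.+2 k / (n.+1%:R * n.+2%:R).
Proof.
rewrite /hyp0F1_term !addSn !addnS !factS !natrM exprS.
have h1 : (n`!%:R : R) != 0 by rewrite pnatr_eq0 -lt0n fact_gt0.
have h2 : (k`!%:R : R) != 0 by rewrite pnatr_eq0 -lt0n fact_gt0.
have h3 : ((n + k)`!%:R : R) != 0 by rewrite pnatr_eq0 -lt0n fact_gt0.
have [a b c e] : [/\ (n.+1%:R : R) = n%:R + 1, (n.+2%:R : R) = n%:R + 2,
   ((n + k).+1%:R : R) = n%:R + k%:R + 1 & ((n + k).+2%:R : R) = n%:R + k%:R + 2].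
  by split; rewrite -?[n.+2]addn2 -?[(n + k).+2]addn2 -?[n.+1]addn1 -?[(n + k).+1]addn1 !natrD.
have h5 : (n.+1%:R : R) != 0 by rewrite pnatr_eq0.
have h6 : (n.+2%:R : R) != 0 by rewrite pnatr_eq0.
have h7 : ((n + k).+1%:R : R) != 0 by rewrite pnatr_eq0.
have h8 : ((n + k).+2%:R : R) != 0 by rewrite pnatr_eq0.
have h9 : (k.+1%:R : R) != 0 by rewrite pnatr_eq0.
rewrite -[k.+1%:R]natr1 in h9 *; rewrite a b c e in h5 h6 h7 h8 *.
field.
by rewrite h6 h5 h3 h7 h8 h2 h9.
Qed.

Variable z : R.
Hypothesis z0 : 0 <= z.

Lemma hyp0F1_term_ge0 n k : 0 <= hyp0F1_term z n k.
Proof. by rewrite /hyp0F1_term divr_ge0 ?mulr_ge0 ?exprn_ge0. Qed.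

Lemma hyp0F1_term_le n k : hyp0F1_term z n k <= exp_coeff z k.
Proof.
rewrite /hyp0F1_term /exp_coeff /= -mulrA ler_wpM2l ?exprn_ge0//.
have k0 : 0 < (k`!%:R : R) by rewrite ltr0n fact_gt0.
have nk0 : 0 < ((n + k)`!%:R : R) by rewrite ltr0n fact_gt0.
rewrite invfM mulrCA ger_pMr ?invr_gt0// ler_pdivrMr// mul1r ler_nat.
by rewrite leq_fact ?leq_addr.
Qed.

(** From degree 1 on, [(n+1)! <= (n+k+1)!] gains a factor [1 / (n+1)] over the exponential series;
    this is what drives [hyp0F1 n] to its constant term 1. *)
Lemma hyp0F1_termS_le n k : hyp0F1_term z n k.+1 <= exp_coeff z k.+1 / n.+1%:R.
Proof.
rewrite /hyp0F1_term /exp_coeff /= -!mulrA ler_wpM2l ?exprn_ge0//.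
have k0 : 0 < (k.+1`!%:R : R) by rewrite ltr0n fact_gt0.
have nk0 : 0 < ((n + k.+1)`!%:R : R) by rewrite ltr0n fact_gt0.
rewrite invfM mulrCA ler_pM2l ?invr_gt0// ler_pdivrMr// mulrC ler_pdivlMr//.
rewrite -natrM ler_nat mulnC -factS leq_fact; lia.
Qed.

Lemma is_cvg_hyp0F1_term n : cvgn (series (hyp0F1_term z n)).
Proof.
apply: (series_le_cvg (hyp0F1_term_ge0 n) _ (hyp0F1_term_le n)); last exact: is_cvg_series_exp_coeff.
by move=> k; exact: le_trans (hyp0F1_term_ge0 n k) (hyp0F1_term_le n k).
Qed.

Definition hyp0F1 n := limn (series (hyp0F1_term z n)).

Lemma hyp0F1_rec n : hyp0F1 n = hyp0F1 n.+1 + z * hyp0F1 n.+2 / (n.+1%:R * n.+2%:R).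
Proof.
(* The last partial sum is one term shorter because its factor [z] raises the degree by one. *)
have s N : series (hyp0F1_term z n) N.+1 = series (hyp0F1_term z n.+1) N.+1 +
    z * series (hyp0F1_term z n.+2) N / (n.+1%:R * n.+2%:R).
  elim: N => [|N ih].
    by rewrite /series/= !big_nat1 !hyp0F1_term0 big_geq// mulr0 mul0r addr0.
  rewrite [LHS]seriesSr ih hyp0F1_termS [series (hyp0F1_term z n.+1) N.+2]seriesSr [series (hyp0F1_term z n.+2) N.+1]seriesSr.
  by ring.
have c1 : (fun N => series (hyp0F1_term z n) N.+1) @ \oo --> hyp0F1 n.
  by rewrite (cvg_shiftS (series (hyp0F1_term z n))); exact: is_cvg_hyp0F1_term.
rewrite -(cvg_lim (@Rhausdorff R) c1); apply/(cvg_lim (@Rhausdorff R)).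
under eq_fun do rewrite s.
apply: cvgD; first by rewrite (cvg_shiftS (series (hyp0F1_term z n.+1))); exact: is_cvg_hyp0F1_term.
apply: cvgM; last exact: cvg_cst.
by apply: cvgM; [exact: cvg_cst|exact: is_cvg_hyp0F1_term].
Qed.

Lemma hyp0F1_bound n : 1 <= hyp0F1 n <= 1 + expR z / n.+1%:R.
Proof.
have S N : 1 <= series (hyp0F1_term z n) N.+1 <= 1 + series (exp_coeff z) N.+1 / n.+1%:R.
  elim: N => [|N /andP[ih1 ih2]].
    rewrite /series/= !big_nat1 hyp0F1_term0 lexx lerDl /exp_coeff/=.
    by rewrite divr_ge0 ?divr_ge0 ?exprn_ge0.
  rewrite [series (hyp0F1_term z n) _]seriesSr [series (exp_coeff z) _]seriesSr.
  rewrite (le_trans ih1) ?lerDl ?hyp0F1_term_ge0//=.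
  by rewrite mulrDl addrA lerD// hyp0F1_termS_le.
have c1 : (fun N => series (hyp0F1_term z n) N.+1) @ \oo --> hyp0F1 n.
  by rewrite (cvg_shiftS (series (hyp0F1_term z n))); exact: is_cvg_hyp0F1_term.
apply/andP; split.
  by apply: (cvgr_to_ge c1); apply: nearW => N; have /andP[] := S N.
apply: (cvgr_to_le c1); apply: nearW => N; have /andP[_ /le_trans] := S N; apply.
rewrite lerD2l ler_pM2r ?invr_gt0//.
apply: nondecreasing_cvgn_le; last exact: is_cvg_series_exp_coeff.
apply: nondecreasing_series => k _ _.
exact: le_trans (hyp0F1_term_ge0 n k) (hyp0F1_term_le n k).
Qed.

Lemma hyp0F1_cvg : hyp0F1 @ \oo --> (1 : R).
Proof.
apply: (@squeeze_cvgr _ _ _ _ (cst 1) (fun n => 1 + expR z * harmonic n)).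
- by apply: nearW => n; exact: hyp0F1_bound.
- exact: cvg_cst.
- rewrite -[X in _ --> X]addr0 -(mulr0 (expR z)).
  by apply: cvgD; [exact: cvg_cst|apply: cvgM; [exact: cvg_cst|exact: cvg_harmonic]].
Qed.

Lemma hyp0F10E t : z = (t / 2) ^+ 2 -> hyp0F1 0 = besselI0 t.
Proof.
move=> zt; rewrite /hyp0F1 /besselI0; congr (limn _); apply/funext => n.
rewrite /series/= big_mkord; apply: eq_bigr => k _.
by rewrite /hyp0F1_term add0n fact0 mulr1 zt -exprM -natrM mulnn.
Qed.

(** By linearity [a - v * hyp0F1] solves the same recurrence; it tends to [v - v = 0], hence
    vanishes, and its value at 0 is the claim. *)
Lemma bessel_recurrence (a : nat -> R) (v t : R) : z = (t / 2) ^+ 2 ->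
  (forall n, a n = a n.+1 + z * a n.+2 / (n.+1%:R * n.+2%:R)) ->
  a @ \oo --> v -> a 0%N = v * besselI0 t.
Proof.
move=> zt ra av; rewrite -(hyp0F10E zt).
apply/eqP; rewrite -subr_eq0; apply/eqP.
apply: (@recurrence_null z (fun n => a n - v * hyp0F1 n)).
  by move=> n; rewrite {1}ra {1}hyp0F1_rec; ring.
have vb : (fun n => v * hyp0F1 n) @ \oo --> v * 1.
  by apply: cvgM; [exact: cvg_cst|exact: hyp0F1_cvg].
have := cvgB av vb; rewrite mulr1 subrr; exact.
Qed.

End BesselRecurrence.

(** * The logarithmic weight *)

Section LogSeries.
Variable R : realType.

Definition logsum (n : nat) (t : R) : R := \sum_(k < n) t ^+ k.+1 / k.+1%:R.

Lemma logsum_ge0 n t : 0 <= t -> 0 <= logsum n t.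
Proof. by move=> t0; apply: sumr_ge0 => k _; rewrite divr_ge0 ?exprn_ge0. Qed.

(** By the geometric sum the remainder has derivative [s^n / (1 - s)], which is nonnegative and
    increasing on [[0, t]]; the remainder vanishes at 0, so the mean value theorem bounds it by [t]
    times the value at [t], and [t < 1]. *)
Lemma logsum_bounds n t : 0 <= t < 1 ->
  0 <= - ln (1 - t) - logsum n t <= t ^+ n / (1 - t).
Proof.
move=> /andP[t0 t1].
pose f s : R := - ln (1 - s) - logsum n s.
have df (s : R) : s < 1 -> is_derive s 1 f (s ^+ n / (1 - s)).
  move=> s1.
  have dl : is_derive s 1 (fun z => - ln (1 - z)) (1 - s)^-1.
    have h1 : is_derive s 1 (fun z : R => 1 - z) (-1).
      have : is_derive s 1 (cst 1 - @id R) (-1) by apply: is_derive_eq; rewrite add0r.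
      by [].
    have h2 : is_derive (1 - s) 1 (@ln R) (1 - s)^-1 by apply: is_derive1_ln; lra.
    have h3 := @is_derive1_comp R (@ln R) (fun z => 1 - z) s _ _ h2 h1.
    have h4 := is_deriveN h3.
    apply: is_derive_eq; rewrite /GRing.scale/=; ring.
  have ds m : is_derive s 1 (logsum m) (\sum_(k < m) s ^+ k).
    elim: m => [|m ih].
      have -> : logsum 0 = cst 0 by apply/funext => z; rewrite /logsum big_ord0.
      by rewrite big_ord0; exact: is_derive_cst.
    have -> : logsum m.+1 = logsum m + m.+1%:R^-1 \*: ((@id R) ^+ m.+1).
      apply/funext => z; rewrite /logsum big_ord_recr/=; congr (_ + _).
      by rewrite mulrC /GRing.scale/= fctE.
    rewrite big_ord_recr/=.
    apply: is_derive_eq; rewrite /GRing.scale/=; congr (_ + _).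
    by rewrite mulr1 mulKf// pnatr_eq0.
  have := is_deriveB dl (ds n); rewrite /f.
  suff -> : (1 - s)^-1 - \sum_(k < n) s ^+ k = s ^+ n / (1 - s) by [].
  have s10 : 1 - s != 0 by rewrite subr_eq0 eq_sym lt_eqF.
  apply: (mulIf s10); rewrite divfK// mulrBl mulVf//.
  by have := subrX1 s n; rewrite -[s - 1]opprB mulNr => h; rewrite mulrC; lra.
have f0 : f 0 = 0.
  rewrite /f subr0 ln1 oppr0 sub0r /logsum big1 ?oppr0// => k _.
  by rewrite expr0n mul0r.
have cf : {within `[0, t], continuous f}.
  apply: continuous_in_subspaceT => s; rewrite inE/= in_itv/= => /andP[_ st].
  apply/differentiable_continuous/derivable1_diffP.
  exact: (@ex_derive _ _ _ _ _ _ _ (df s (le_lt_trans st t1))).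
have df' (s : R) : s \in `]0, t[ -> is_derive s 1 f (s ^+ n / (1 - s)).
  by rewrite in_itv/= => /andP[_ st]; apply: df; exact: lt_trans t1.
have [c] := MVT_segment t0 df' cf.
rewrite in_itv/= => /andP[c0 ct]; rewrite f0 !subr0 -/(f t) => ->.
have c1 : 0 < 1 - c by lra.
have t2 : 0 < 1 - t by lra.
rewrite mulr_ge0 ?divr_ge0 ?exprn_ge0 ?(ltW c1)//=.
apply: (@le_trans _ _ (c ^+ n / (1 - c))).
  have q0 : 0 <= c ^+ n / (1 - c) by rewrite divr_ge0 ?exprn_ge0 ?(ltW c1).
  by rewrite -[leRHS]mulr1 ler_wpM2l// ltW.
apply: ler_pM; rewrite ?exprn_ge0 ?invr_ge0 ?(ltW c1)//.
  by rewrite lerXn2r ?nnegrE.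
by rewrite lef_pV2 ?posrE//; lra.
Qed.

Lemma logsum_le n t : 0 <= t < 1 -> logsum n t <= - ln (1 - t).
Proof. by move=> /(logsum_bounds n)/andP[+ _]; rewrite subr_ge0. Qed.

Lemma logsum_cvg t : 0 <= t < 1 -> logsum^~ t @ \oo --> - ln (1 - t).
Proof.
move=> t01; have /andP[t0 t1] := t01.
have c : (fun n => - ln (1 - t) - t ^+ n / (1 - t)) @ \oo --> - ln (1 - t).
  rewrite -[X in _ --> X](subr0 (- ln (1 - t))) -(mul0r (1 - t)^-1).
  apply: cvgB; first exact: cvg_cst.
  by apply: cvgM; [apply: cvg_expr; rewrite ger0_norm|exact: cvg_cst].
apply: (squeeze_cvgr _ c (cvg_cst (- ln (1 - t)))).
apply: nearW => n; have /andP[h1 h2] := logsum_bounds n t01.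
by apply/andP; split; lra.
Qed.

End LogSeries.

(** * Termwise integration of the logarithmic series over the disc *)

Section LogIntegral.
Variable R : realType.
Let plane := (measurableTypeR R * measurableTypeR R)%type.
Let mu2 : {measure set plane -> \bar R} := @leb2 R.
Variables (x : R * R) (r : R).
Hypothesis r0 : 0 < r.

Let w := weight x r.
Let lnw y := - ln (1 - w y).

(* Holds at [y = x] too, both sides being [0] since [r / 0 = 0] and [ln 0 = 0]. *)
Lemma ln_dist2 y : ln (r / dist2 x y) = 2^-1 * - ln (1 - weight x r y).
Proof.
have e : 1 - weight x r y = dist2 x y ^+ 2 / r ^+ 2.
  rewrite /weight opprB addrC subrK /dist2 sqr_sqrtr ?addr_ge0 ?sqr_ge0//.
  by rewrite -(sqrrN (x.1 - _)) -(sqrrN (x.2 - _)) !opprB.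
have [d0|d0] := eqVneq (dist2 x y) 0.
  by rewrite e d0 invr0 mulr0 expr0n mul0r ln0// oppr0 mulr0.
have dpos : 0 < dist2 x y by rewrite lt_neqAle eq_sym d0 sqrtr_ge0.
rewrite e -expr_div_n lnXn ?divr_gt0// -[r / _]invf_div lnV ?posrE ?divr_gt0//.
by rewrite -mulr_natr; field.
Qed.

Lemma weight_lt1 y : y != x -> weight x r y < 1.
Proof.
move=> yx; rewrite lt_neqAle weight_le1 andbT; apply: contra yx => /eqP.
rewrite /weight => /eqP; rewrite -subr_eq0 addrAC subrr sub0r oppr_eq0.
rewrite mulf_eq0 invr_eq0 sqrf_eq0 (gt_eqF r0) orbF paddr_eq0 ?sqr_ge0//.
rewrite !sqrf_eq0 !subr_eq0 => /andP[/eqP h1 /eqP h2].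
by rewrite [y]surjective_pairing [x]surjective_pairing h1 h2.
Qed.

Let w01 y : disc x r y -> y != x -> 0 <= w y < 1.
Proof. by move=> /(discP x r0 y).1/ltW w0 /weight_lt1 ->; rewrite w0. Qed.

(** The centre must be discarded: there [w = 1] and the partial sums are harmonic numbers, whereas
    [lnw x = 0] by the convention [ln 0 = 0]. *)
Let ae_neq (P : plane -> Prop) :
  (forall y, y != x -> P y) -> \forall y \ae mu2, P y.
Proof.
move=> yxP.
have xE : [set x] = [set x.1] `*` [set x.2] :> set plane.
  apply/seteqP; split=> [_ ->//|[y1 y2] [/= -> ->]].
  by rewrite [RHS]surjective_pairing.
exists [set x]; split.
- by rewrite xE; apply: measurableX; exact: measurable_set1.
- rewrite xE.
  transitivity (@lebesgue_measure R [set x.1] * @lebesgue_measure R [set x.2])%E.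
    by apply: product_measure1E; exact: measurable_set1.
  by rewrite lebesgue_measure_set1 mul0e.
- by move=> y /= nPy; apply: contrapT => /eqP/yxP.
Qed.

Let contdisc (f : R * R -> R) := forall p, cdisc x r p -> {for p, continuous f}.

Let measurable_disc_fun (f : R * R -> R) : contdisc f ->
  measurable_fun (disc x r : set plane) f.
Proof.
move=> cf; apply: continuous_measurable_plane; first exact: open_disc.
by move=> p /(disc_cdisc r0)/cf.
Qed.

Let measurable_lnw : measurable_fun (disc x r : set plane) lnw.
Proof.
apply: measurable_funN; apply: measurableT_comp; first exact: measurable_ln.
apply: measurable_disc_fun => p _.
by apply: cvgB; [exact: cvg_cst|exact: continuous_weight].
Qed.

Let cont_cst1 : contdisc (cst 1).
Proof. by move=> p _; exact: cvg_cst. Qed.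

Let cont_logsum u n : contdisc u -> contdisc (fun y => logsum n (w y) * u y).
Proof. exact: continuous_weight_sum. Qed.

Let integral_logsum u n : contdisc u ->
  (\int[mu2]_(y in disc x r) (logsum n (w y) * u y)%:E =
   (\sum_(k < n) moment x r u k.+1 / k.+1%:R)%:E)%E.
Proof.
move=> cu; have := integral_weight_sum r0 n cu; rewrite /Rintegral => <-.
rewrite fineK//; apply: integrable_fin_num; first exact: measurable_disc.
exact: (integrable_disc r0 (continuous_weight_sum (n := n) cu)).
Qed.

Let lnw_ge0 y : disc x r y -> 0 <= lnw y.
Proof.
by move=> /(discP x r0 y).1 w0; rewrite /lnw oppr_ge0 ln_le0// gerBl ltW.
Qed.

(** The summands are [pi r^2 / ((k+1) (k+2))]. Their sums stay below [pi r^2], which bounds the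
    integral of the singular logarithm. *)
Let sum_moment_cst1 n :
  \sum_(k < n) moment x r (cst 1) k.+1 / k.+1%:R = pi * r ^+ 2 * (1 - n.+1%:R^-1).
Proof.
elim: n => [|n ih]; first by rewrite big_ord0 invr1 subrr mulr0.
rewrite big_ord_recr/= ih moment_cst1//.
have h1 : (n.+1%:R : R) != 0 by rewrite pnatr_eq0.
have h2 : (n.+2%:R : R) != 0 by rewrite pnatr_eq0.
move: h1 h2; rewrite -[n.+2%:R]natr1; move: (n.+1%:R : R) => q h1 h2.
by field; rewrite h1 h2.
Qed.

(** Monotone convergence: the partial sums of the series increase and their integrals are at most
    [pi r^2]. *)
Let lnw_integrable : mu2.-integrable (disc x r) (EFin \o lnw).
Proof.
have mD := measurable_disc x r0.
pose S n y := (logsum n (w y) * cst 1 y)%:E.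
have mS n : measurable_fun (disc x r : set plane) (S n).
  apply/measurable_EFinP; apply: measurable_disc_fun.
  exact: (cont_logsum (n := n) cont_cst1).
have w0 y : disc x r y -> 0 <= w y by move=> /(discP x r0 y).1/ltW.
have S0 n y : disc x r y -> (0 <= S n y)%E.
  by move=> /w0 wy; rewrite lee_fin mulr1 logsum_ge0.
have Smono y : disc x r y -> {homo S^~ y : m n / (m <= n)%N >-> (m <= n)%E}.
  move=> /w0 wy; apply/nondecreasing_seqP => n.
  by rewrite lee_fin !mulr1 /logsum big_ord_recr/= lerDl divr_ge0 ?exprn_ge0.
have cS y : disc x r y -> cvgn (S^~ y).
  by move=> xy; apply: ereal_nondecreasing_is_cvgn; exact: Smono.
have mlim : measurable_fun (disc x r : set plane) (fun y => limn (S^~ y)).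
  by apply: (@emeasurable_fun_cvg _ plane R _ S) => // y /cS.
apply/integrableP; split; first exact/measurable_EFinP.
apply: (@le_lt_trans _ _ (pi * r ^+ 2)%:E); last exact: ltry.
apply: (@le_trans _ _ (\int[mu2]_(y in disc x r) limn (S^~ y))%E).
  apply: ge0_le_integral => //.
    by apply: measurableT_comp => //; exact/measurable_EFinP.
  move=> y xy; rewrite /= ger0_norm ?lnw_ge0//.
  (* Only an upper bound of [lnw] by the limit is needed, so the centre, where [lnw] is 0, needs no
     separate null set. *)
  have [yx|yx] := eqVneq y x.
    rewrite yx in xy *; rewrite /lnw /w /weight !subrr expr0n/= addr0 mul0r subr0 subrr ln0// oppr0.
    by apply: lime_ge; [exact: cS|apply: nearW => n; exact: S0].
  have /cvg_lim <- // : S^~ y @ \oo --> (lnw y)%:E.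
  rewrite /S; under eq_fun do rewrite mulr1.
  by apply: cvg_EFin; [exact: nearW|exact: logsum_cvg (w01 xy yx)].
rewrite (monotone_convergence mu2 mD mS S0 Smono).
apply: lime_le.
  exact: (cvgP _ (cvg_monotone_convergence mD mS S0 Smono)).
apply: nearW => n; rewrite integral_logsum// sum_moment_cst1 lee_fin.
have A0 : 0 <= pi * r ^+ 2 :> R by rewrite mulr_ge0 ?pi_ge0 ?sqr_ge0.
by rewrite ler_piMr// gerBl invr_ge0.
Qed.

(** Dominated convergence with majorant [M * lnw], where [M] bounds [|u|]: the partial sums are
    nonnegative and lie below [lnw] off the centre. *)
Lemma moment_sum_cvg u : contdisc u ->
  mu2.-integrable (disc x r) (fun y => (lnw y * u y)%:E) /\
  (fun n => (\sum_(k < n) moment x r u k.+1 / k.+1%:R)%:E) @ \oo -->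
    (\int[mu2]_(y in disc x r) (lnw y * u y)%:E)%E.
Proof.
move=> cu; have mD := measurable_disc x r0.
have [M M0 uM] := continuous_cdisc_bounded r0 cu.
have gi : mu2.-integrable (disc x r) (fun y => (M%:E * (lnw y)%:E)%E).
  exact: integrableZl.
have [] := @dominated_convergence _ _ _ mu2 _ mD
  (fun n y => (logsum n (w y) * u y)%:E) (fun y => (lnw y * u y)%:E) _ _ _ _ gi.
- move=> n; apply/measurable_EFinP; apply: measurable_disc_fun.
  exact: (cont_logsum (n := n) cu).
- apply/measurable_EFinP; apply: measurable_funM => //.
  exact: measurable_disc_fun.
- apply: ae_neq => y yx xy; apply: cvg_EFin; first exact: nearW.
  by apply: cvgM; [exact: logsum_cvg (w01 xy yx)|exact: cvg_cst].
- apply: ae_neq => y yx n xy.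
  have wy := w01 xy yx; have /andP[w0 _] := wy.
  rewrite /= lee_fin normrM mulrC ler_pM// ?uM//; first exact: disc_cdisc.
  by rewrite ger0_norm ?logsum_ge0//; exact: logsum_le.
move=> fi _ h; split => //.
by under eq_fun do rewrite -integral_logsum//.
Qed.

Lemma moment_sum_panharmonic (D : set (R * R)) (u : R * R -> R) (mu : R) :
  cdisc x r `<=` D -> mu != 0 -> panharmonic mu D u ->
  (fun n => \sum_(k < n) moment x r u k.+1 / k.+1%:R) @ \oo -->
    pi * r ^+ 2 * u x * (besselI0 (mu * r) - 1) / (mu * r / 2) ^+ 2.
Proof.
move=> xrD mu0 [uC2 upan].
have cu : contdisc u by move=> p /xrD; case: uC2 => -[cu _] _; exact: cu.
pose A : R := pi * r ^+ 2; pose z := (mu * r / 2) ^+ 2.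
have rn0 := lt0r_neq0 r0; have pn0 := lt0r_neq0 (pi_gt0 R).
have A0 : A != 0 by rewrite /A mulf_neq0// expf_neq0.
have zn0 : z != 0.
  by rewrite /z expf_neq0// mulf_neq0 ?mulf_neq0// invr_eq0 pnatr_eq0.
pose V k := k.+1%:R * moment x r u k / A.
(* Shifting by one puts the recurrence in the normal form of [bessel_recurrence]; the value at 0 is
   the one that the recurrence forces at [k = -1]. *)
pose a n := if n is k.+1 then V k else V 0%N + z * V 1%N / 2.
have momentE k : moment x r u k = A * V k / k.+1%:R.
  rewrite /V; have : (k.+1%:R : R) != 0 by rewrite pnatr_eq0.
  by move: (k.+1%:R : R) => q q0; field; rewrite A0 q0.
have VE k : V k = V k.+1 + z * V k.+2 / (k.+2%:R * k.+3%:R).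
  have : mu ^+ 2 * r ^+ 2 * moment x r u k.+2 =
      4 * k.+2%:R * (k.+1%:R * moment x r u k - k.+2%:R * moment x r u k.+1).
    by apply: (moment_rec r0 k xrD uC2) => y /upan/eqP; rewrite subr_eq0 => /eqP.
  rewrite !momentE /z.
  have : (k.+1%:R : R) != 0 by rewrite pnatr_eq0.
  have : (k.+2%:R : R) != 0 by rewrite pnatr_eq0.
  have : (k.+3%:R : R) != 0 by rewrite pnatr_eq0.
  move: (V k) (V k.+1) (V k.+2) (k.+1%:R : R) (k.+2%:R : R) (k.+3%:R : R) A0.
  generalize A => B v0 v1 v2 q1 q2 q3 B0 q30 q20 q10 h.
  have : 4 * q2 * B * v0 = 4 * q2 * B * (v1 + (mu * r / 2) ^+ 2 * v2 / (q2 * q3)).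
    transitivity (4 * q2 * (q1 * (B * v0 / q1) - q2 * (B * v1 / q2)) + 4 * q2 * B * v1).
      by field; rewrite q10 q20.
    by rewrite -h; field; rewrite q20 q30.
  by apply: mulfI; rewrite !mulf_neq0.
have ra n : a n = a n.+1 + z * a n.+2 / (n.+1%:R * n.+2%:R).
  by case: n => [|n] /=; [rewrite mul1r|exact: VE].
have av : a @ \oo --> u x.
  by rewrite -cvg_shiftS; exact: (moment_cvg r0 cu).
have z0 : 0 <= z by exact: sqr_ge0.
have a0 := bessel_recurrence z0 (erefl _) ra av.
(* Each summand is [A V_(k+1) / ((k+1) (k+2)) = A (a_k - a_(k+1)) / z]. *)
have sE n : \sum_(k < n) moment x r u k.+1 / k.+1%:R = A * (a 0%N - a n) / z.
  elim: n => [|n ih]; first by rewrite big_ord0 subrr mulr0 mul0r.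
  rewrite big_ord_recr ih.
  transitivity (A * (a 0%N - a n) / z + moment x r u n.+1 / n.+1%:R) => [//|].
  rewrite momentE; have -> : a n = a n.+1 + z * V n.+1 / (n.+1%:R * n.+2%:R) by exact: ra.
  have : (n.+1%:R : R) != 0 by rewrite pnatr_eq0.
  have : (n.+2%:R : R) != 0 by rewrite pnatr_eq0.
  move: (n.+1%:R : R) (n.+2%:R : R) (a 0%N) (a n.+1) (V n.+1) => q1 q2 b0 b1 v q20 q10.
  by field; rewrite zn0 q10 q20.
under eq_fun do rewrite sE.
rewrite -/z -/A.
have -> : A * u x * (besselI0 (mu * r) - 1) / z = A * (a 0%N - u x) / z.
  by rewrite a0; ring.
apply: cvgM; last exact: cvg_cst.
apply: cvgM; first exact: cvg_cst.
by apply: cvgB => //; exact: cvg_cst.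
Qed.

End LogIntegral.

Theorem theorem5p1 (R : realType) (D : set (R * R)) (u : R * R -> R) (mu : R) :
  open D -> connected D -> mu != 0 -> panharmonic mu D u ->
  forall (x : R * R) (r : R), D x -> 0 < r -> cdisc x r `<=` D ->
  ((afun (mu * r) * u x)%:E =
   ((pi * r ^+ 2)^-1)%:E *
   \int[@leb2 R]_(y in disc x r) (u y * ln (r / dist2 x y))%:E)%E.
Proof.
move=> _ _ mu0 pan x r _ r0 xrD.
have cu p : cdisc x r p -> {for p, continuous u}.
  by move=> /xrD; case: pan => -[[cu _] _] _; exact: cu.
have [fi sumI] := moment_sum_cvg r0 cu.
have sumR := moment_sum_panharmonic r0 xrD mu0 pan.
have TE : (\int[@leb2 R]_(y in disc x r) (- ln (1 - weight x r y) * u y)%:E =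
    (pi * r ^+ 2 * u x * (besselI0 (mu * r) - 1) / (mu * r / 2) ^+ 2)%:E)%E.
  apply/esym; rewrite -(cvg_lim (@ereal_hausdorff R) sumI).
  apply/esym/(cvg_lim (@ereal_hausdorff R)).
  by apply: cvg_EFin => //; exact: nearW.
(* The factor [1/2] comes from [log (r / |x - y|) = - log (1 - w) / 2]; together with
   [1 / (mu r / 2)^2] it produces the [2 / (mu r)^2] of [afun]. *)
transitivity (((pi * r ^+ 2)^-1)%:E * ((2^-1)%:E *
    \int[@leb2 R]_(y in disc x r) (- ln (1 - weight x r y) * u y)%:E))%E.
  rewrite TE -!EFinM /afun; congr EFin.
  have pn0 : (pi : R) != 0 by rewrite gt_eqF ?pi_gt0.
  have rn0 := lt0r_neq0 r0.
  move: (pi : R) (besselI0 _) pn0 => p b pn0.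
  by field; rewrite rn0 mu0 pn0.
congr (_ * _)%E; rewrite -integralZl//; last exact: measurable_disc.
by apply: eq_integral => y _; rewrite -EFinM ln_dist2//; congr EFin; ring.
Qed.
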